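(* Let $S$ be a semigroup with zero such that $Z(S)\neq S$. If $S$ is reduced and $|Z(S)^{*}|\geq 2$, then $$\mathrm{Girth}(\overrightarrow{\Gamma}(S))=\mathrm{Girth}(\overrightarrow{\Gamma}_{E}(S))=\mathrm{Girth}(\overrightarrow{\mathrm{AG}}(S))=2.$$
   Context: Let $S$ be a semigroup with zero, not necessarily commutative; for $A\subseteq S$, $A^{*}=A\setminus\{0\}$. $S$ is reduced if it has no nonzero nilpotent elements. An element $x\in S$ is a left (resp. right) zero divisor if $xy=0$ (resp. $yx=0$) for some $y\in S^{*}$; $Z(S)$ is the set of all elements that are left or right zero divisors. For $x\in S$, $\mathrm{Ann}_{l}(x)=\{s\in S: sx=0\}$ and $\mathrm{Ann}_{r}(x)=\{s\in S: xs=0\}$. The following are simple digraphs (no loops, no multiple arcs), all with vertex set $Z(S)^{*}$; for distinct $x,y\in Z(S)^{*}$: in the zero-divisor digraph $\overrightarrow{\Gamma}(S)$, $x\to y$ is an arc iff $xy=0$; in the extended zero-divisor digraph $\overrightarrow{\Gamma}_{E}(S)$, $x\to y$ is an arc iff $x^{n}y^{m}=0$ for some positive integers $n,m$ with $x^{n}\neq 0$ and $y^{m}\neq 0$; in the annihilator digraph $\overrightarrow{\mathrm{AG}}(S)$, $x\to y$ is an arc iff $\mathrm{Ann}_{l}(xy)\setminus(\mathrm{Ann}_{l}(x)\cup\mathrm{Ann}_{l}(y))\neq\emptyset$ or $\mathrm{Ann}_{r}(xy)\setminus(\mathrm{Ann}_{r}(x)\cup\mathrm{Ann}_{r}(y))\neq\emptyset$.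 $\mathrm{Girth}$ is the length of a shortest directed cycle ($\infty$ if there is none); $x\to y\to x$ with $x\neq y$ is a directed cycle of length $2$. *)

(* Defs.v *)
From HB Require Import structures.
From mathcomp Require Import all_boot.
From mathcomp Require Import boolp classical_sets functions cardinality.

Set Implicit Arguments.
Unset Strict Implicit.
Unset Printing Implicit Defensive.

Local Open Scope classical_set_scope.

(* The [choiceType] structure that [semigroupType] carries is no restriction
   here: classically, every type has one. *)
HB.mixin Record Semigroup_hasZero S of Semigroup S := {
  zerog : S;
  mul0g : left_zero zerog (@mul S);
  mulg0 : right_zero zerog (@mul S)
}.

#[short(type="zeroSemigroupType")]
HB.structure Definition ZeroSemigroup := {S of Semigroup_hasZero S & Semigroup S}.

Arguments zerog {s}.

Section ZeroDivisors.
Variable S : zeroSemigroupType.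
Implicit Types (x y s : S) (A : set S).

(* [x * ... * x] with [n] factors for [0 < n]; the value at [n = 0] is junk,
   as [S] need not have a unit. *)
Definition spow x n : S := iterop n (@mul S) x x.

Definition nilpotent x : Prop := exists n : nat, (0 < n)%N /\ spow x n = zerog.

Definition reduced : Prop := forall x, nilpotent x -> x = zerog.

Definition nonzero A : set S := A `\ zerog.

Definition left_zero_divisor x : Prop :=
  exists2 y, nonzero setT y & (x * y)%g = zerog.

Definition right_zero_divisor x : Prop :=
  exists2 y, nonzero setT y & (y * x)%g = zerog.

Definition zero_divisors : set S :=
  [set x | left_zero_divisor x \/ right_zero_divisor x].

Definition annl x : set S := [set s | (s * x)%g = zerog].

Definition annr x : set S := [set s | (x * s)%g = zerog].

End ZeroDivisors.

Arguments reduced : clear implicits.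
Arguments zero_divisors : clear implicits.

Record digraph (T : Type) := Digraph {
  vertices : set T;
  is_arc : T -> T -> Prop;
  is_arc_vertices : forall x y, is_arc x y -> vertices x /\ vertices y;
  is_arc_irrefl : forall x, ~ is_arc x x
}.

Section SimpleDigraph.
Variables (T : Type) (V : set T) (r : T -> T -> Prop).

Definition simple_arc x y : Prop := [/\ V x, V y, x <> y & r x y].

Lemma simple_arc_vertices x y : simple_arc x y -> V x /\ V y.
Proof. by case. Qed.

Lemma simple_arc_irrefl x : ~ simple_arc x x.
Proof. by case=> _ _ /(_ erefl). Qed.

Definition simple_digraph : digraph T :=
  Digraph simple_arc_vertices simple_arc_irrefl.

End SimpleDigraph.

Section Girth.
Variables (T : eqType) (G : digraph T).

(* [c] lists the distinct vertices of the cycle once; since there are no loops,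
   the size of [c] is then at least 2. [ucycle] also accepts the empty list. *)
Definition dicycle (c : seq T) : Prop :=
  c <> [::] /\ ucycle (fun x y => `[< is_arc G x y >]) c.

Definition dicycle_length (n : nat) : bool :=
  `[< exists2 c, dicycle c & size c = n >].

(* [None] stands for an infinite girth. *)
Definition girth : option nat :=
  match pselect (exists n, dicycle_length n) with
  | left h => Some (ex_minn h)
  | right _ => None
  end.

End Girth.

Section Digraphs.
Variable S : zeroSemigroupType.

Definition zero_divisor_digraph : digraph S :=
  simple_digraph (nonzero (zero_divisors S)) (fun x y => (x * y)%g = zerog).

Definition extended_zero_divisor_digraph : digraph S :=
  simple_digraph (nonzero (zero_divisors S)) (fun x y =>
    exists n m : nat, [/\ (0 < n)%N, (0 < m)%N,
      (spow x n * spow y m)%g = zerog, spow x n <> zerog & spow y m <> zerog]).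

Definition annihilator_digraph : digraph S :=
  simple_digraph (nonzero (zero_divisors S)) (fun x y =>
    annl (x * y)%g `\` (annl x `|` annl y) !=set0 \/
    annr (x * y)%g `\` (annr x `|` annr y) !=set0).

End Digraphs.

Arguments zero_divisor_digraph : clear implicits.
Arguments extended_zero_divisor_digraph : clear implicits.
Arguments annihilator_digraph : clear implicits.

(* Main.v *)
Require Import Defs.
From mathcomp Require Import all_boot.
From mathcomp Require Import boolp classical_sets functions cardinality.

Local Open Scope classical_set_scope.
Local Open Scope card_scope.

(** In a reduced semigroup [x * y = 0] forces [y * x = 0], because
    [(y * x) ^ 2 = y * (x * y) * x]. So a nonzero zero divisor [x] has a nonzero
    partner [y] annihilating it on both sides; [y] differs from [x], whose square
    cannot vanish. The zero-divisor digraph thus contains the 2-cycle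
    [x -> y -> x], and this cycle survives in the two other digraphs: in the
    extended one with exponents 1, and in the annihilator digraph because
    [Z(S) <> S] provides an [s] that is not a zero divisor. Such an [s]
    annihilates [x * y = 0] but neither [x] nor [y]. Since a digraph without loops
    has no cycle shorter than 2, all three girths are 2. *)

(** The absence of loops makes 2 the least conceivable girth, so a single
    2-cycle determines it. *)
Lemma girth_eq2 (T : eqType) (G : digraph T) (x y : T) :
  is_arc G x y -> is_arc G y x -> girth G = Some 2%N.
Proof.
move=> xy yx.
have neq_xy : x != y by apply/eqP => e; apply: (@is_arc_irrefl _ G x); rewrite {2}e.
have cycle2 : dicycle_length G 2.
  apply/asboolP; exists [:: x; y] => //; split=> //.
  rewrite /ucycle /= inE neq_xy !andbT.
  by apply/andP; split; apply/asboolP.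
have length_ge2 n : dicycle_length G n -> (2 <= n)%N.
  move=> /asboolP [[|z [|w c]] [c0 /andP [cyc _]] <-] //.
  by move: cyc; rewrite /= andbT => /asboolP loop; case: (@is_arc_irrefl _ G z).
rewrite /girth; case: pselect => [h|]; last by case; exists 2%N.
case: ex_minnP => n /length_ge2 n_ge2 /(_ _ cycle2) n_le2.
by congr Some; apply/eqP; rewrite eqn_leq n_le2 n_ge2.
Qed.

Lemma reduced_sqr_eq0 (S : zeroSemigroupType) (x : S) :
  reduced S -> (x * x)%g = zerog -> x = zerog.
Proof. by move=> hred xx; apply: hred; exists 2%N. Qed.

(** [(y * x) ^ 2] contains the factor [x * y]. *)
Lemma reduced_mul_eq0C (S : zeroSemigroupType) (x y : S) :
  reduced S -> (x * y)%g = zerog -> (y * x)%g = zerog.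
Proof.
move=> hred xy; apply: reduced_sqr_eq0 => //.
by rewrite mulgA -(mulgA y x y) xy mulg0 mul0g.
Qed.

Lemma reduced_zero_divisor_partner (S : zeroSemigroupType) (x : S) :
  reduced S -> nonzero (zero_divisors S) x ->
  exists y, [/\ nonzero (zero_divisors S) y, x <> y,
                (x * y)%g = zerog & (y * x)%g = zerog].
Proof.
move=> hred [Zx x0].
have [y y0 xy] : exists2 y, y <> zerog & (x * y)%g = zerog.
  case: Zx => [[y [_ y0] xy]|[y [_ y0] yx]]; exists y => //.
  exact: reduced_mul_eq0C.
have yx := reduced_mul_eq0C _ _ _ hred xy.
exists y; split=> //; first by split=> //; left; exists x.
by move=> exy; apply: x0; apply: reduced_sqr_eq0 => //; rewrite {2}exy.
Qed.

Lemma extended_zero_divisor_arc (S : zeroSemigroupType) (x y : S) :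
  is_arc (zero_divisor_digraph S) x y ->
  is_arc (extended_zero_divisor_digraph S) x y.
Proof. by case=> Zx Zy xy xy0; split=> //; exists 1%N, 1%N; case: Zx Zy => _ ? []. Qed.

(** An element that is not a zero divisor lies in [annl (x * y)], which is all of
    [S], but in neither [annl x] nor [annl y]. *)
Lemma annihilator_arc (S : zeroSemigroupType) (x y : S) :
  zero_divisors S <> setT ->
  is_arc (zero_divisor_digraph S) x y -> is_arc (annihilator_digraph S) x y.
Proof.
move=> hZ [Zx Zy nxy xy0]; split=> //; left.
have [s Zs] : exists s, ~ zero_divisors S s.
  by apply/existsNP => Zall; apply: hZ; apply/seteqP; split=> // s _; apply: Zall.
exists s; split; first by rewrite /annl /= xy0 mulg0.
by case=> sz; apply: Zs; left; [exists x|exists y] => //; split=> //; [case: Zx|case: Zy].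
Qed.

Theorem corollary5p5 (S : zeroSemigroupType)
  (hZ : zero_divisors S <> setT)
  (hred : reduced S)
  (hcard : `I_2 #<= nonzero (zero_divisors S)) :
  [/\ girth (zero_divisor_digraph S) = girth (extended_zero_divisor_digraph S),
      girth (extended_zero_divisor_digraph S) = girth (annihilator_digraph S)
    & girth (annihilator_digraph S) = Some 2%N].
Proof.
have [x Zx] : nonzero (zero_divisors S) !=set0.
  apply/set0P/eqP => Z0; move: hcard; rewrite Z0 card_le0 => /eqP I2.
  by have : `I_2 0%N by []; rewrite I2.
have [y [Zy nxy xy yx]] := reduced_zero_divisor_partner _ _ hred Zx.
have arc_xy : is_arc (zero_divisor_digraph S) x y by [].
have arc_yx : is_arc (zero_divisor_digraph S) y x by split=> // /esym.
rewrite (girth_eq2 _ _ _ _ arc_xy arc_yx).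
rewrite (girth_eq2 _ _ _ _ (extended_zero_divisor_arc _ _ _ arc_xy)
                           (extended_zero_divisor_arc _ _ _ arc_yx)).
by rewrite (girth_eq2 _ _ _ _ (annihilator_arc _ _ _ hZ arc_xy)
                              (annihilator_arc _ _ _ hZ arc_yx)).
Qed.
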